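(* Let $n\ge 0$ and $d\geq n+1$ be integers, let $p$ be a prime, and let ${\bf a}_1,\dots,{\bf a}_N\in{\mathbb N}^{n+1}$ be distinct vectors, each with coordinate sum $d$. Let $U$ be the set of $u=(u_0,\dots,u_n)\in{\mathbb N}^{n+1}$ with $\sum_{i=0}^n u_i=d$ and $u_i>0$ for all $i=0,\dots,n$. Let $\Lambda_1,\dots,\Lambda_N$ be indeterminates and $f_\Lambda(x_0,\dots,x_n)=\sum_{k=1}^N\Lambda_k x^{{\bf a}_k}$. For $u,v\in U$ let $A_{uv}(\Lambda)\in{\mathbb Z}[\Lambda_1,\dots,\Lambda_N]$ be the coefficient of $x^{pu-v}$ in $f_\Lambda(x)^{p-1}$, let $\bar A_{uv}(\Lambda)\in{\mathbb F}_p[\Lambda_1,\dots,\Lambda_N]$ be its reduction mod $p$, and let $\bar A(\Lambda)=[\bar A_{uv}(\Lambda)]_{u,v\in U}$. If $U\subseteq\{{\bf a}_k\}_{k=1}^N$, then $\det\bar A(\Lambda)\in{\mathbb F}_p[\Lambda_1,\dots,\Lambda_N]$ is not the zero polynomial.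
   Context: ${\mathbb N}$ denotes the nonnegative integers. For ${\bf a}=(a_0,\dots,a_n)$, $x^{\bf a}=x_0^{a_0}\cdots x_n^{a_n}$. Explicitly, $$A_{uv}(\Lambda)=\sum \frac{(p-1)!}{e_1!\cdots e_N!}\Lambda_1^{e_1}\cdots\Lambda_N^{e_N},$$ the sum being over $(e_1,\dots,e_N)\in{\mathbb N}^N$ with $e_1+\cdots+e_N=p-1$ and $\sum_{k=1}^N e_k{\bf a}_k=pu-v$ (so it is $0$ if there is no such tuple). The rows and columns of $\bar A(\Lambda)$ are both indexed by the finite nonempty set $U$, so its determinant is well defined. *)

(* Defs.v *)
From HB Require Import structures.
From mathcomp Require Import all_boot all_order all_algebra.
From mathcomp Require Import mpoly.

Set Implicit Arguments.
Unset Strict Implicit.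
Unset Printing Implicit Defensive.

Import GRing.Theory.
Local Open Scope ring_scope.

(* The bound in 'X_{1..n.+1 < d.+1} (total degree < d.+1) only serves to make
   the ambient type finite; it excludes no exponent of total degree d. *)
Definition interior_exps (n d : nat) : {set 'X_{1..n.+1 < d.+1}} :=
  [set u : 'X_{1..n.+1 < d.+1} |
    (mdeg u == d) && [forall i : 'I_n.+1, (0 < u i)%N]].

Definition f_Lambda (n N : nat) (a : 'I_N -> 'X_{1..n.+1}) :
    {mpoly {mpoly int[N]}[n.+1]} :=
  \sum_(k < N) ('X_k : {mpoly int[N]}) *: 'X_[a k].

(* Subtraction of monomial exponents is truncated in the library: the guard
   makes the coefficient 0 when p u - v has a negative coordinate. *)
Definition hw_coef (n N : nat) (a : 'I_N -> 'X_{1..n.+1}) (p : nat)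
    (u v : 'X_{1..n.+1}) : {mpoly int[N]} :=
  if (v <= u *+ p)%MM then (f_Lambda a ^+ p.-1)@_(u *+ p - v)%MM else 0.

Definition hw_coef_mod (n N : nat) (a : 'I_N -> 'X_{1..n.+1}) (p : nat)
    (u v : 'X_{1..n.+1}) : {mpoly 'F_p[N]} :=
  map_mpoly (intr : int -> 'F_p) (hw_coef a p u v).

(* Rows and columns follow the same enumeration of U, so the determinant does
   not depend on it. *)
Definition hw_matrix_mod (n d N : nat) (a : 'I_N -> 'X_{1..n.+1}) (p : nat) :
    'M[{mpoly 'F_p[N]}]_#|interior_exps n d| :=
  let u_ (i : 'I_#|interior_exps n d|) : 'X_{1..n.+1 < d.+1} := enum_val i in
  \matrix_(i, j) hw_coef_mod a p (u_ i) (u_ j).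

(* Main.v *)
(* Specialize Lambda_k to T^(|a_k|^2).  A term of A_uv comes from p-1 vectors
   a_k which together with v have barycentre u, so the sum of their p squared
   norms is p|u|^2 plus the sum of their squared distances to u.  Hence
   A_uv(T) T^(|v|^2) = T^(p|u|^2) B_uv(T), where the constant term of B_uv
   counts the families whose vectors all equal u: it is 1 if u = v and 0
   otherwise.  Therefore det B has constant term 1, and det A(T) <> 0. *)
Require Import Defs.
From mathcomp Require Import all_boot all_order all_algebra.
From mathcomp Require Import mpoly.
From mathcomp Require Import zify.

Import GRing.Theory.
Local Open Scope ring_scope.

Definition mnm_norm2 {m : nat} (u : 'X_{1..m}) : nat := (\sum_i u i ^ 2)%N.

(* Subtraction is truncated: at most one of the two squares is nonzero. *)
Definition mnm_dist2 {m : nat} (u v : 'X_{1..m}) : nat :=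
  (\sum_i ((u i - v i) ^ 2 + (v i - u i) ^ 2))%N.

Lemma mnm_dist2_eq0 {m : nat} (u v : 'X_{1..m}) :
  (mnm_dist2 u v == 0%N) = (u == v).
Proof.
rewrite /mnm_dist2 sum_nat_eq0; apply/forallP/eqP => [h | -> i].
  by apply/mnmP => i; have /eqP := h i; lia.
by rewrite subnn.
Qed.

Lemma mnm_norm2_dist2 {m : nat} (u v : 'X_{1..m}) :
  (mnm_norm2 v + mnm_norm2 u = (\sum_i 2 * u i * v i) + mnm_dist2 v u)%N.
Proof.
rewrite /mnm_norm2 /mnm_dist2 -!big_split; apply: eq_bigr => i _ /=.
by case: (leqP (u i) (v i)) => h; nia.
Qed.

(** Sum the polarization identity [mnm_norm2_dist2] over the [w i] and [v]. These [r.+1] points add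
    up to [r.+1] times [u], so the cross terms total [2 * r.+1 * mnm_norm2 u], half of which cancels
    the copies of [mnm_norm2 u] on the left. *)
Lemma sum_norm2_barycentre {m r : nat} (w : 'I_r -> 'X_{1..m})
    (u v : 'X_{1..m}) :
  (\sum_i w i + v = u *+ r.+1)%MM ->
  (\sum_i mnm_norm2 (w i) + mnm_norm2 v =
   r.+1 * mnm_norm2 u + (\sum_i mnm_dist2 (w i) u + mnm_dist2 v u))%N.
Proof.
move=> bary.
have cross : (\sum_i (\sum_j 2 * u j * w i j) + \sum_j 2 * u j * v j
              = 2 * r.+1 * mnm_norm2 u)%N.
  rewrite exchange_big -big_split /mnm_norm2 big_distrr; apply: eq_bigr => j _ /=.
  have /(congr1 (fun x : 'X_{1..m} => x j)) := bary.
  by rewrite mnmDE mnm_sumE mulmnE -big_distrr /= => h; nia.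
have split : (\sum_i mnm_norm2 (w i) + r * mnm_norm2 u
    = \sum_i (\sum_j 2 * u j * w i j) + \sum_i mnm_dist2 (w i) u)%N.
  rewrite -[X in (X * _)%N](card_ord r) -sum_nat_const -!big_split.
  by apply: eq_bigr => i _; apply: mnm_norm2_dist2.
have := mnm_norm2_dist2 u v; nia.
Qed.

(** Indexing by the choice of a term in each factor, rather than by exponent tuples, replaces
    multinomial coefficients by a count of families. *)
Lemma mcoeff_sumX_exp (R : comNzRingType) {m N : nat} (r : nat) (c : 'I_N -> R)
    (a : 'I_N -> 'X_{1..m}) (x : 'X_{1..m}) :
  ((\sum_k c k *: 'X_[a k]) ^+ r)@_x =
  \sum_(g : {ffun 'I_r -> 'I_N} | (\sum_i a (g i))%MM == x) \prod_i c (g i).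
Proof.
rewrite -[r in LHS]card_ord -prodr_const.
rewrite (bigA_distr_bigA (fun _ k => c k *: 'X_[a k])) raddf_sum /=.
rewrite [RHS]big_mkcond; apply: eq_bigr => g _.
rewrite scaler_prod -(big_morph _ (@mpolyXD m R) (@mpolyX0 m R)).
by rewrite mcoeffZ mcoeffX; case: eqP => _; rewrite (mulr0, mulr1).
Qed.

(* The entry B_uv of the specialized matrix, with r = p - 1. *)
Definition hw_spec (F : comNzRingType) {m N : nat} (a : 'I_N -> 'X_{1..m})
    (r : nat) (u v : 'X_{1..m}) : {poly F} :=
  \sum_(g : {ffun 'I_r -> 'I_N} | (\sum_i a (g i) + v == u *+ r.+1)%MM)
    'X^(\sum_i mnm_dist2 (a (g i)) u + mnm_dist2 v u)%N.

Lemma hw_coef_specialized (F : comNzRingType) {n N : nat} (r : nat)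
    (a : 'I_N -> 'X_{1..n.+1}) (h : {rmorphism {mpoly int[N]} -> {poly F}})
    (u v : 'X_{1..n.+1}) :
  (forall k, h 'X_k = 'X^(mnm_norm2 (a k))) ->
  h (hw_coef a r.+1 u v) * 'X^(mnm_norm2 v) =
  'X^(r.+1 * mnm_norm2 u) * hw_spec F a r u v.
Proof.
move=> hX; rewrite /hw_coef /hw_spec /=.
case: ifPn => [le_vu | nle_vu]; last first.
  (* The guard agrees with an empty sum: a family with barycentre [u] forces [v] to be at most
     [u *+ r.+1]. *)
  rewrite rmorph0 mul0r big_pred0 ?mulr0 // => g.
  by apply: contraNF nle_vu => /eqP <-; apply: lem_addl.
rewrite /f_Lambda mcoeff_sumX_exp rmorph_sum big_distrl big_distrr /=.
apply: eq_big => [g | g /eqP bary].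
  apply/eqP/eqP => [-> | <-]; first by rewrite submK.
  by rewrite addmK.
rewrite rmorph_prod (eq_bigr _ (fun i _ => hX (g i))) prodrXr -!exprD.
rewrite (sum_norm2_barycentre (fun i => a (g i)) u v) //.
by rewrite bary submK.
Qed.

Lemma hw_spec_at0 (F : comNzRingType) {m N : nat} (r : nat) (a : 'I_N -> 'X_{1..m})
    (u v : 'X_{1..m}) (k : 'I_N) :
  injective a -> a k = u -> (hw_spec F a r u v).[0] = (u == v)%:R.
Proof.
move=> a_inj ak; rewrite /hw_spec horner_sum.
under eq_bigr do rewrite hornerXn expr0n addn_eq0 sum_nat_eq0 mnm_dist2_eq0.
case: (eqVneq u v) => [<- | ne_uv]; last first.
  by apply: big1 => g _; rewrite andbF.
under eq_bigr do rewrite andbT.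
have bary_k : (\sum_(i < r) a ([ffun=> k] i) + u == u *+ r.+1)%MM.
  apply/eqP/mnmP => j; rewrite mnmDE mnm_sumE mulmnE.
  under eq_bigr do rewrite ffunE ak.
  by rewrite sum_nat_const card_ord mulnS addnC mulnC.
(* Since [a] is injective, only the constant family at [k] has all its vectors equal to [u]. *)
rewrite (bigD1 [ffun=> k]) //= big1 => [|g /andP[_ ne_gk]].
  case: forallP => [_ | []]; first by rewrite addr0.
  by move=> i; rewrite ffunE ak mnm_dist2_eq0 eqxx.
suff /negPf -> : ~~ [forall (i | true), mnm_dist2 (a (g i)) u == 0%N] by [].
apply: contra ne_gk => /forallP at_u; apply/eqP.
apply/ffunP => i; rewrite ffunE; apply: a_inj; rewrite ak.
by have := at_u i; rewrite mnm_dist2_eq0 => /eqP.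
Qed.

Theorem theorem2p3 (n d p N : nat) (a : 'I_N -> 'X_{1..n.+1})
    (hd : (n.+1 <= d)%N) (hp : prime p)
    (a_inj : injective a) (a_deg : forall k : 'I_N, mdeg (a k) = d)
    (hU : forall u : 'X_{1..n.+1 < d.+1},
        u \in interior_exps n d -> exists k : 'I_N, a k = bmnm u) :
  \det (hw_matrix_mod d a p) != 0.
Proof.
case: p hp => // r _.
pose F : fieldType := 'F_(r.+1).
pose s (k : 'I_N) : {poly F} := 'X^(mnm_norm2 (a k)).
(* The specialization is split as reduction mod p ([h2]) followed by [h1], so that [h1] alone acts
   on the given determinant. *)
pose h1 : {rmorphism {mpoly F[N]} -> {poly F}} := mmap (@polyC F) s.
pose h2 : {rmorphism {mpoly int[N]} -> {mpoly F[N]}} := map_mpoly intr.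
pose U := interior_exps n d.
pose e (i : 'I_#|U|) : 'X_{1..n.+1} := bmnm (enum_val i).
pose B : 'M[{poly F}]_#|U| := \matrix_(i, j) hw_spec F a r (e i) (e j).
have hX k : h1 (h2 'X_k) = s k by rewrite /h2 /h1 /= map_mpolyX mmapX mmap1U.
have fact : map_mx h1 (hw_matrix_mod d a r.+1)
      *m diag_mx (\row_j 'X^(mnm_norm2 (e j)))
    = diag_mx (\row_i 'X^(r.+1 * mnm_norm2 (e i))) *m B.
  apply/matrixP => i j; rewrite mul_mx_diag mul_diag_mx !mxE.
  exact: (hw_coef_specialized F r a (h1 \o h2)).
have detB : (\det B).[0] = 1.
  (* Evaluation at 0 is a ring morphism, and it sends [B] to the identity matrix. *)
  rewrite -[LHS]/(horner_eval 0 (\det B)) -det_map_mx -[RHS](det1 _ #|U|).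
  congr (\det _); apply/matrixP => i j; rewrite !mxE /=.
  have [k ak] := hU (enum_val i) (enum_valP i).
  rewrite /horner_eval (hw_spec_at0 _ _ _ _ _ k) //.
  by rewrite (inj_eq val_inj) (inj_eq enum_val_inj).
(* A zero determinant would kill the left side of [fact], while the right side is a product of
   powers of the variable times [\det B], nonzero in a domain. *)
apply: contra_eqN (congr1 determinant fact) => /eqP det0.
rewrite !det_mulmx det_map_mx det0 rmorph0 mul0r eq_sym !det_diag mulf_neq0 //.
  by apply/prodf_neq0 => i _; rewrite mxE monic_neq0 ?monicXn.
by apply: contra_eq_neq detB => ->; rewrite horner0 eq_sym oner_neq0.
Qed.
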